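(* Let $\mathcal{X} \subset \mathbb{R}^n$, let $\mathcal{J} = \{1,\dots,p\}$, and let $a_i : \mathcal{X} \to \mathbb{R}^m$, $b_i : \mathcal{X} \to \mathbb{R}$ ($i \in \mathcal{J}$) and $\pi_{\rm des} : \mathcal{X} \to \mathbb{R}^m$ be Lipschitz continuous on $\mathcal{X}$, with $\|a_i(x)\| = 1$ for all $x \in \mathcal{X}$ and $i \in \mathcal{J}$. Let $K(x) = \{u \in \mathbb{R}^m : a_i(x)^\top u \le b_i(x)\ \forall i \in \mathcal{J}\}$. Let $\pi_{\rm f} : \mathcal{X} \to \mathbb{R}^m$ be Lipschitz continuous and bounded on $\mathcal{X}$ with $\pi_{\rm f}(x) \in K(x)$ for all $x \in \mathcal{X}$. Set $r(x) = \min_{i \in \mathcal{J}} \big(b_i(x) - a_i(x)^\top \pi_{\rm f}(x)\big)$ and $v_{\rm des}(x) = \pi_{\rm des}(x) - \pi_{\rm f}(x)$. Then for every $x \in \mathcal{X}$ the minimizer $\pi_{\rm socp}(x)$ of $$\min_{u \in \mathbb{R}^m} \ \|u - \pi_{\rm des}(x)\|^2 \quad \text{subject to} \quad \|u - \pi_{\rm f}(x)\| \le r(x)$$ is given by $$\pi_{\rm socp}(x) = \pi_{\rm f}(x) + \min\big(r(x), \|v_{\rm des}(x)\|\big)\, \frac{v_{\rm des}(x)}{\|v_{\rm des}(x)\|},$$ where the quotient $v_{\rm des}(x)/\|v_{\rm des}(x)\|$ is understood to be $0$ when $v_{\rm des}(x) = 0$.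
   Context: $\|\cdot\|$ is the Euclidean norm; $m, n, p \ge 1$ are integers. A function $f : \mathcal{X} \to \mathbb{R}^k$ is Lipschitz continuous on $\mathcal{X}$ if there is $L \ge 0$ with $\|f(x_1) - f(x_2)\| \le L\|x_1 - x_2\|$ for all $x_1, x_2 \in \mathcal{X}$. *)

(* Defs.v *)
From mathcomp Require Import all_boot all_order all_algebra.
From mathcomp Require Import classical_sets reals.
Set Implicit Arguments.
Unset Strict Implicit.
Unset Printing Implicit Defensive.
Import Order.TTheory GRing.Theory Num.Theory.
Local Open Scope classical_set_scope.
Local Open Scope ring_scope.

Definition dotp (R : realType) (k : nat) (u v : 'cV[R]_k) : R :=
  (u^T *m v) 0 0.

(* The norm that MathComp-Analysis puts on matrices is the sup norm, hence
   this separate definition (and those of Lipschitz continuity and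
   boundedness below, which are relative to it). *)
Definition enorm (R : realType) (k : nat) (u : 'cV[R]_k) : R :=
  Num.sqrt (\sum_(i < k) u i 0 ^+ 2).

(* A function on X is encoded as a total function of which only the values
   on X are constrained. [N] is the norm of the codomain: [enorm] for R^k,
   the absolute value for R. *)
Definition lipschitz_wrt (R : realType) (n : nat) (V : zmodType) (N : V -> R)
    (X : set 'cV[R]_n) (f : 'cV[R]_n -> V) : Prop :=
  exists2 L : R, 0 <= L & forall x1 x2, X x1 -> X x2 ->
    N (f x1 - f x2) <= L * enorm (x1 - x2).

Definition lipschitz_vec (R : realType) (n k : nat) (X : set 'cV[R]_n)
    (f : 'cV[R]_n -> 'cV[R]_k) : Prop :=
  lipschitz_wrt (@enorm R k) X f.

Definition lipschitz_scal (R : realType) (n : nat) (X : set 'cV[R]_n)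
    (f : 'cV[R]_n -> R) : Prop :=
  lipschitz_wrt (fun y : R => `|y|) X f.

Definition bounded_vec (R : realType) (n k : nat) (X : set 'cV[R]_n)
    (f : 'cV[R]_n -> 'cV[R]_k) : Prop :=
  exists M : R, forall x, X x -> enorm (f x) <= M.

Definition polyK (R : realType) (m n p : nat)
    (a : 'I_p -> 'cV[R]_n -> 'cV[R]_m) (b : 'I_p -> 'cV[R]_n -> R)
    (x : 'cV[R]_n) : set 'cV[R]_m :=
  [set u | forall i, dotp (a i x) u <= b i x].

(* Minimum of a nonempty finite family; the default value of the iterated
   minimum is the first member of the family, so it has no effect. *)
Definition fam_min (R : realType) (p : nat) (hp : (0 < p)%N)
    (F : 'I_p -> R) : R :=
  \big[Num.min/F (Ordinal hp)]_(i < p) F i.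

Definition radius (R : realType) (m n p : nat) (hp : (0 < p)%N)
    (a : 'I_p -> 'cV[R]_n -> 'cV[R]_m) (b : 'I_p -> 'cV[R]_n -> R)
    (pi_f : 'cV[R]_n -> 'cV[R]_m) (x : 'cV[R]_n) : R :=
  fam_min hp (fun i => b i x - dotp (a i x) (pi_f x)).

Definition argmin (R : realType) (T : Type) (C : set T) (J : T -> R) : set T :=
  [set u | C u /\ forall w, C w -> J u <= J w].

Definition normalize (R : realType) (k : nat) (v : 'cV[R]_k) : 'cV[R]_k :=
  if v == 0 then 0 else (enorm v)^-1 *: v.

(* Main.v *)
Require Import Defs.
From mathcomp Require Import all_boot all_order all_algebra.
From mathcomp Require Import classical_sets reals.
From mathcomp Require Import ring lra.
Import Order.TTheory GRing.Theory Num.Theory.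
Local Open Scope classical_set_scope.
Local Open Scope ring_scope.

(** Translating by [pi_f x], the claim is that the closed ball of radius
    [r >= 0] around the origin has [z = min(r, |v|) v / |v|] as its unique
    point nearest to [v].  By Cauchy-Schwarz, [z] satisfies the variational
    inequality [<w - z, z - v> >= 0] for all [w] in the ball, and hence
    [|w - v|^2 >= |z - v|^2 + |w - z|^2], which gives both minimality and
    uniqueness. *)

Lemma dotpE {R : realType} {k : nat} (u v : 'cV[R]_k) :
  dotp u v = \sum_(i < k) u i 0 * v i 0.
Proof. by rewrite /dotp mxE; apply: eq_bigr => i _; rewrite mxE. Qed.

Lemma dotpC {R : realType} {k : nat} (u v : 'cV[R]_k) : dotp u v = dotp v u.
Proof. by rewrite !dotpE; apply: eq_bigr => i _; rewrite mulrC. Qed.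

Lemma dotpDl {R : realType} {k : nat} (u v w : 'cV[R]_k) :
  dotp (u + v) w = dotp u w + dotp v w.
Proof. by rewrite /dotp linearD mulmxDl mxE. Qed.

Lemma dotpZl {R : realType} {k : nat} (c : R) (u w : 'cV[R]_k) :
  dotp (c *: u) w = c * dotp u w.
Proof. by rewrite /dotp linearZ -scalemxAl mxE. Qed.

Lemma dotpBl {R : realType} {k : nat} (u v w : 'cV[R]_k) :
  dotp (u - v) w = dotp u w - dotp v w.
Proof. by rewrite dotpDl -scaleN1r dotpZl mulN1r. Qed.

Lemma dotpBr {R : realType} {k : nat} (u v w : 'cV[R]_k) :
  dotp w (u - v) = dotp w u - dotp w v.
Proof. by rewrite dotpC dotpBl !(dotpC _ w). Qed.

Lemma dotpZr {R : realType} {k : nat} (c : R) (u w : 'cV[R]_k) :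
  dotp w (c *: u) = c * dotp w u.
Proof. by rewrite dotpC dotpZl dotpC. Qed.

Lemma enorm_ge0 {R : realType} {k : nat} (u : 'cV[R]_k) : 0 <= enorm u.
Proof. exact: sqrtr_ge0. Qed.

Lemma enorm_sqr {R : realType} {k : nat} (u : 'cV[R]_k) :
  enorm u ^+ 2 = dotp u u.
Proof.
by rewrite dotpE sqr_sqrtr //; apply: sumr_ge0 => i _; exact: sqr_ge0.
Qed.

Lemma enorm0 {R : realType} {k : nat} : enorm (0 : 'cV[R]_k) = 0.
Proof.
by apply/eqP; rewrite -sqrf_eq0 enorm_sqr -(scale0r 0) dotpZl mul0r.
Qed.

Lemma enorm_eq0 {R : realType} {k : nat} (u : 'cV[R]_k) :
  (enorm u == 0) = (u == 0).
Proof.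
apply/idP/eqP => [|->]; last by rewrite enorm0.
rewrite -sqrf_eq0 enorm_sqr dotpE psumr_eq0 => [/allP u0|i _]; last first.
  exact: sqr_ge0.
apply/matrixP => i j; rewrite ord1 mxE; apply/eqP.
by have := u0 i (mem_index_enum i); rewrite /= mulf_eq0 orbb.
Qed.

Lemma enormZ {R : realType} {k : nat} (c : R) (u : 'cV[R]_k) :
  0 <= c -> enorm (c *: u) = c * enorm u.
Proof.
move=> c0; apply/eqP; rewrite -(eqrXn2 (n := 2)) ?enorm_ge0 ?mulr_ge0 ?enorm_ge0//.
by rewrite exprMn !enorm_sqr dotpZl dotpZr mulrA.
Qed.

(** Cauchy-Schwarz: for nonzero [u], [v], the square of the norm of [enorm v *: u - enorm u *: v]
    expands to [2 |u| |v| (|u| |v| - <u,v>)], and the positive factor [|u| |v|] cancels. *)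
Lemma dotp_le_enorm {R : realType} {k : nat} (u v : 'cV[R]_k) :
  dotp u v <= enorm u * enorm v.
Proof.
have [->|u0] := eqVneq u 0; first by rewrite enorm0 mul0r -(scale0r 0) dotpZl mul0r.
have [->|v0] := eqVneq v 0; first by rewrite enorm0 mulr0 -(scale0r 0) dotpZr mul0r.
have uv0 : 0 < enorm u * enorm v.
  by rewrite mulr_gt0 // lt0r enorm_eq0 ?u0 ?v0 enorm_ge0.
have := sqr_ge0 (enorm (enorm v *: u - enorm u *: v)).
rewrite enorm_sqr !(dotpBl, dotpBr, dotpZl, dotpZr) -!enorm_sqr (dotpC v u) => h.
by rewrite -(ler_pM2l uv0); lra.
Qed.

Lemma enorm_sqrB {R : realType} {k : nat} (w z v : 'cV[R]_k) :
  enorm (w - v) ^+ 2 =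
  enorm (w - z) ^+ 2 + enorm (z - v) ^+ 2 + 2 * dotp (w - z) (z - v).
Proof.
rewrite !enorm_sqr !(dotpBl, dotpBr) (dotpC v w) (dotpC z w) (dotpC v z).
ring.
Qed.

(** For [0 <= r], the metric projection onto the closed ball of radius [r] around the origin,
    written so that it unfolds to the formula of the theorem. *)
Definition ball_proj {R : realType} {k : nat} (r : R) (v : 'cV[R]_k) : 'cV[R]_k :=
  Num.min r (enorm v) *: normalize v.

(** Removes the special case [v = 0] of [normalize]: since [0 <= r], it falls into the first
    branch. *)
Lemma ball_projE {R : realType} {k : nat} (r : R) (v : 'cV[R]_k) :
  0 <= r ->
  ball_proj r v = if enorm v <= r then v else (r / enorm v) *: v.
Proof.
rewrite /ball_proj /normalize => r0.
have [->|v0] := eqVneq v 0; first by rewrite enorm0 r0 scaler0.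
have [h|h] := leP (enorm v) r; last by rewrite scalerA.
by rewrite scalerA mulfV ?scale1r// enorm_eq0.
Qed.

Lemma enorm_ball_proj {R : realType} {k : nat} (r : R) (v : 'cV[R]_k) :
  0 <= r -> enorm (ball_proj r v) <= r.
Proof.
move=> r0; rewrite ball_projE//; have [//|rv] := leP (enorm v) r.
have v0 := le_lt_trans r0 rv.
by rewrite enormZ ?divr_ge0 ?enorm_ge0// divfK// gt_eqF.
Qed.

Lemma ball_proj_variational {R : realType} {k : nat} (r : R) (v w : 'cV[R]_k) :
  0 <= r -> enorm w <= r -> 0 <= dotp (w - ball_proj r v) (ball_proj r v - v).
Proof.
move=> r0 wr; rewrite ball_projE//; have [_|rv] := leP (enorm v) r.
  by rewrite subrr -(scale0r 0) dotpZr mul0r.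
have v0 := le_lt_trans r0 rv.
have -> : (r / enorm v) *: v - v = (r / enorm v - 1) *: v.
  by rewrite scalerBl scale1r.
(* Outside the ball [r / |v| - 1 <= 0], so it remains to see that [<w - z, v> <= 0] for
   [z = (r / |v|) v]. *)
rewrite dotpZr mulr_le0 ?subr_le0 ?ler_pdivrMr ?mul1r ?(ltW rv)//.
(* Here [<z, v> = r |v|], while [<w, v> <= |w| |v| <= r |v|]. *)
rewrite dotpBl dotpZl -enorm_sqr expr2 mulrA divfK ?gt_eqF// subr_le0.
by apply: le_trans (dotp_le_enorm _ _) _; rewrite ler_pM2r.
Qed.

Lemma ball_proj_dist {R : realType} {k : nat} (r : R) (v w : 'cV[R]_k) :
  0 <= r -> enorm w <= r ->
  enorm (w - ball_proj r v) ^+ 2 + enorm (ball_proj r v - v) ^+ 2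
    <= enorm (w - v) ^+ 2.
Proof.
move=> r0 wr; rewrite (enorm_sqrB w (ball_proj r v) v) lerDl mulr_ge0//.
exact: ball_proj_variational.
Qed.

Lemma argmin_ball {R : realType} {k : nat} (r : R) (c d : 'cV[R]_k) :
  0 <= r ->
  argmin [set u | enorm (u - c) <= r] (fun u => enorm (u - d) ^+ 2)
  = [set c + ball_proj r (d - c)].
Proof.
move=> r0; set z := ball_proj r (d - c).
have zr : enorm (c + z - c) <= r by rewrite addrC addKr enorm_ball_proj.
(* The distance inequality for the centred ball, applied to [u - c] and [d - c] and translated back
   by [c]. *)
have dist u : enorm (u - c) <= r ->
    enorm (u - (c + z)) ^+ 2 + enorm (c + z - d) ^+ 2 <= enorm (u - d) ^+ 2.
  move=> /(ball_proj_dist _ (d - c) _ r0); rewrite -/z.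
  by rewrite opprB !addrA subrK (addrC z) opprD addrA.
apply/seteqP; split=> [u [ur umin]|_ ->] /=.
  (* Uniqueness: [u] is no farther from [d] than the feasible point [c + z], which leaves no room
     for the extra square in [dist]. *)
  have duz : enorm (u - (c + z)) ^+ 2 <= 0.
    by move: (dist _ ur) (umin _ zr) => /= h1 h2; lra.
  apply/eqP; rewrite -subr_eq0 -enorm_eq0 -sqrf_eq0.
  by rewrite eq_le duz sqr_ge0.
split=> // w /dist; apply: le_trans.
by rewrite lerDr sqr_ge0.
Qed.

(** The default value of the iterated minimum is itself a member of the family, so it obeys the same
    bound. *)
Lemma fam_min_ge {R : realType} {p : nat} (hp : (0 < p)%N) (F : 'I_p -> R) (c : R) :
  (forall i, c <= F i) -> c <= fam_min hp F.
Proof.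
move=> cF; rewrite /fam_min.
by apply: (big_ind (fun y => c <= y)) => // y z cy cz; rewrite le_min cy.
Qed.

Theorem mainTheorem2 (R : realType) (m n p : nat)
    (hm : (0 < m)%N) (hn : (0 < n)%N) (hp : (0 < p)%N)
    (X : set 'cV[R]_n)
    (a : 'I_p -> 'cV[R]_n -> 'cV[R]_m) (b : 'I_p -> 'cV[R]_n -> R)
    (pi_des pi_f : 'cV[R]_n -> 'cV[R]_m)
    (a_lip : forall i, lipschitz_vec X (a i))
    (b_lip : forall i, lipschitz_scal X (b i))
    (des_lip : lipschitz_vec X pi_des)
    (a_unit : forall x i, X x -> enorm (a i x) = 1)
    (f_lip : lipschitz_vec X pi_f)
    (f_bnd : bounded_vec X pi_f)
    (f_feas : forall x, X x -> polyK a b x (pi_f x)) :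
  let r := radius hp a b pi_f in
  let v_des := fun x => pi_des x - pi_f x in
  forall x, X x ->
    argmin [set u : 'cV[R]_m | enorm (u - pi_f x) <= r x]
           (fun u : 'cV[R]_m => enorm (u - pi_des x) ^+ 2)
    = [set pi_f x + Num.min (r x) (enorm (v_des x)) *: normalize (v_des x)].
Proof.
move=> r v_des x Xx; apply: argmin_ball.
(* The radius is nonnegative because [pi_f x] satisfies every constraint. *)
by apply: fam_min_ge => i; rewrite subr_ge0; exact: f_feas.
Qed.
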